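(* Let $(A_r)_{r\ge 0}$ be a sequence of diagram algebras over an integral domain $R$ with field of fractions $\mathbb{F}$ (see context). Let $r>1$, $\nu\in\widehat A_r$ and $\mathsf t\in\mathrm{Std}_r(\nu)$. Let $1\le s<r$ and write $\lambda=\mathsf t(s)$. Let $a\in A_s$ and suppose $$u^*_{\mathsf t_{[0,s]}}a\equiv\sum_{\mathsf s\in\mathrm{Std}_s(\lambda)}r_{\mathsf s}u^*_{\mathsf s}\pmod{A_s^{\triangleright\lambda}}$$ with $r_{\mathsf s}\in R$. Then there exist coefficients $r_{\mathsf z}\in R$ such that $$u^*_{\mathsf t}a\equiv\sum_{\mathsf s\in\mathrm{Std}_s(\lambda)}r_{\mathsf s}\,u^*_{\mathsf t_{[s,r]}}u^*_{\mathsf s}+\sum_{\substack{\mathsf z\in\mathrm{Std}_r(\nu)\\ \mathsf z_{[s,r]}\triangleright\mathsf t_{[s,r]}\\ \mathsf z(s)\triangleright\lambda}}r_{\mathsf z}u^*_{\mathsf z}\pmod{A_r^{\triangleright\nu}}.$$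
   Context: **Cellular algebras.** A cellular algebra over $R$ is a unital $R$-algebra $A$ with an algebra involution $*$ ($R$-linear anti-automorphism, $(x^* )^*=x$), a finite poset $(\widehat A,\trianglerighteq)$, a finite index set $T(\lambda)$ for each $\lambda\in\widehat A$, and an $R$-basis $\{c^\lambda_{st}:\lambda\in\widehat A,\ s,t\in T(\lambda)\}$ such that, with $A^{\triangleright\lambda}$ (resp. $A^{\trianglerighteq\lambda}$) the span of the $c^\mu_{st}$ with $\mu\triangleright\lambda$ (resp. $\mu\trianglerighteq\lambda$): (a) for $t\in T(\lambda)$, $a\in A$ there are $r(a;t,v)\in R$ with $c^\lambda_{st}a\equiv\sum_v r(a;t,v)c^\lambda_{sv}$ mod $A^{\triangleright\lambda}$ for all $s$; (b) $(c^\lambda_{st})^*\equiv c^\lambda_{ts}$ mod $A^{\triangleright\lambda}$. The cell module $\Delta(\lambda)$ is the right $A$-module, free over $R$ on $\{c^\lambda_t\}$, with $c^\lambda_t a=\sum_v r(a;t,v)c^\lambda_v$. There is an $A$-$A$-bimodule isomorphism $\alpha_\lambda:A^{\trianglerighteq\lambda}/A^{\triangleright\lambda}\to\Delta(\lambda)^*\otimes_R\Delta(\lambda)$, $c^\lambda_{st}+A^{\triangleright\lambda}\mapsto (c^\lambda_s)^*\otimes c^\lambda_t$, where $M^*$ is the left module obtained from a right module $M$ via $*$. $A$ is cyclic cellular if every cell module is cyclic. A cell filtration of a right module is a finite filtration $0=M_0\subseteq\dots\subseteq M_p$ with $M_i/M_{i-1}\cong\Delta(\lambda^{(i)})$; it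 is order preserving if $\lambda^{(i)}\triangleright\lambda^{(i+1)}$ for all $i$. **Sequence of diagram algebras.** $(A_r)_{r\ge0}$ is an increasing sequence of cellular algebras over $R$, with unital inclusions and compatible involutions; $\widehat A_r$ is the poset of $A_r$, $\Delta_r(\lambda)$ its cell modules, $A_r^{\mathbb F}=A_r\otimes_R\mathbb F$. For each $\lambda\in\widehat A_r$ a generator $\delta_r(\lambda)$ of $\Delta_r(\lambda)$ and an element $m_\lambda\in A_r^{\trianglerighteq\lambda}$ with $\alpha_\lambda(m_\lambda+A_r^{\triangleright\lambda})=\delta_r(\lambda)^*\otimes\delta_r(\lambda)$ are fixed; $\Delta_r(\lambda)$ is identified with $(m_\lambda A_r+A_r^{\triangleright\lambda})/A_r^{\triangleright\lambda}$ via $\delta_r(\lambda)a\leftrightarrow m_\lambda a+A_r^{\triangleright\lambda}$. Axioms: (D1) $A_0=R$ ($\widehat A_0=\{\varnothing\}$, $\Delta_0(\varnothing)=R$, $m_\varnothing=1$); (D2) each $A_r$ is cyclic cellular; (D3) $m_\lambda=m_\lambda^*$; (D4) each $A_r^{\mathbb F}$ is split semisimple; (D5) (restriction coherence) for each $\mu\in\widehat A_{r+1}$ the restriction of $\Delta_{r+1}(\mu)$ to $A_r$ has an order preserving cell filtration; (D6) below. **Branching diagram, branching factors.** $\widehat A$ is the graded directed graph with vertex set $\widehat A_r$ at level $r$ and an edge $\lambda\to\mu$ ($\lambda\in\widehat A_{r-1}$, $\mu\in\widehat A_r$) iff $\Delta_{r-1}(\lambda)$ is a subquotient in the order preserving cell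 filtration of the restriction of $\Delta_r(\mu)$ to $A_{r-1}$. Fixing such a filtration $(M_j)$ with isomorphisms $M_j/M_{j-1}\cong\Delta_{r-1}(\lambda_j)$, the branching factor $d_{\lambda_j\to\mu}\in A_r$ is a chosen element with $\delta_r(\mu)d_{\lambda_j\to\mu}\in M_j$ whose class in $M_j/M_{j-1}$ corresponds to $\delta_{r-1}(\lambda_j)$. (D6): there are elements $u_{\mu\to\lambda}\in A_{r+1}$ for each edge $\mu\to\lambda$ ($\mu\in\widehat A_r,\lambda\in\widehat A_{r+1}$) with $m_\lambda d_{\mu\to\lambda}=(u_{\mu\to\lambda})^*m_\mu$. **Paths, Murphy basis.** For $\lambda\in\widehat A_s$, $\nu\in\widehat A_r$, $s\le r$, $\mathrm{Std}_{s,r}(\nu\setminus\lambda)$ is the set of directed paths $\mathsf t=(\lambda=\mathsf t(s)\to\mathsf t(s+1)\to\dots\to\mathsf t(r)=\nu)$; $\mathrm{Std}_r(\nu)=\mathrm{Std}_{0,r}(\nu\setminus\varnothing)$. $\mathsf t_{[p,q]}$ is the truncation of $\mathsf t$ to levels $p,\dots,q$. For $\mathsf t\in\mathrm{Std}_{s,r}(\nu\setminus\lambda)$, $d_{\mathsf t}=d_{\mathsf t(r-1)\to\mathsf t(r)}\cdots d_{\mathsf t(s)\to\mathsf t(s+1)}$ and $u_{\mathsf t}=u_{\mathsf t(s)\to\mathsf t(s+1)}\cdots u_{\mathsf t(r-1)\to\mathsf t(r)}$; then $u_{\mathsf t}^*m_\lambda=m_\nu d_{\mathsf t}$, and for $\mathsf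 t\in\mathrm{Std}_r(\nu)$, $u_{\mathsf t}^*=m_\nu d_{\mathsf t}$. The Murphy basis $m^\nu_{\mathsf t}=m_\nu d_{\mathsf t}+A_r^{\triangleright\nu}=u_{\mathsf t}^*+A_r^{\triangleright\nu}$, $\mathsf t\in\mathrm{Std}_r(\nu)$, is known to be an $R$-basis of $\Delta_r(\nu)$. **Dominance order on paths.** For paths between the same levels $s$ and $r$ (with any endpoints), $\mathsf s\trianglerighteq\mathsf t$ iff $\mathsf s(j)\trianglerighteq\mathsf t(j)$ for all $s\le j\le r$; $\mathsf s\triangleright\mathsf t$ means in addition $\mathsf s\ne\mathsf t$. *)

(* Defs.v *)
From mathcomp Require Import all_boot all_order all_algebra.

Set Implicit Arguments.
Unset Strict Implicit.
Unset Printing Implicit Defensive.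

Import Order.TTheory GRing.Theory.

Local Open Scope ring_scope.

Section Modules.

Variables (R : comNzRingType) (V : lmodType R) (I : finType).

Definition is_basis (b : I -> V) : Prop :=
  forall v : V, exists! x : {ffun I -> R}, v = \sum_i x i *: b i.

Definition span_of (P : pred I) (b : I -> V) (v : V) : Prop :=
  exists x : I -> R, v = \sum_(i | P i) x i *: b i.

Definition eqmod (P : V -> Prop) (x y : V) : Prop := P (x - y).

End Modules.

(* [coef a t v] is the scalar r(a; t, v), which depends neither on the shape   *)
(* index s of c_st nor on any choice, since the c_sv are linearly independent.  *)
(* The order is written as x ⊵ y = (y <= x)%O.                                  *)
Record cellularAlg (R : comNzRingType) (d : Order.disp_t) := CellularAlg {
  carrier :> algType R;
  star : {linear carrier -> carrier};
  weight : finPOrderType d;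
  idx : weight -> finType;
  cbas : forall l : weight, idx l -> idx l -> carrier;
  coef : forall l : weight, carrier -> idx l -> idx l -> R;
  cball := fun i : {l : weight & (idx l * idx l)%type} =>
            cbas (tagged i).1 (tagged i).2;
  Agt := fun l : weight => span_of (fun i => (l < tag i)%O) cball;
  Age := fun l : weight => span_of (fun i => (l <= tag i)%O) cball;
  starM : forall x y, star (x * y) = star y * star x;
  starK : involutive star;
  cbas_basis : is_basis cball;
  cbas_mulr : forall (l : weight) (t : idx l) (a : carrier) (s : idx l),
    eqmod (Agt l) (cbas s t * a) (\sum_v coef a t v *: cbas s v);
  cbas_star : forall (l : weight) (s t : idx l),
    eqmod (Agt l) (star (cbas s t)) (cbas t s)
}.

Arguments star {R d c}.
Arguments Agt {R d} c l _.
Arguments Age {R d} c l _.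

Section CellModules.

Variables (R : comNzRingType) (d : Order.disp_t) (A : cellularAlg R d).

(* The cell module, as the free module on [idx l] : x stands for             *)
(* \sum_t x t c_t.                                                            *)
Definition cellMod (l : weight A) := {ffun idx l -> R^o}.

Definition cellAct (l : weight A) (x : cellMod l) (a : A) : cellMod l :=
  [ffun v => \sum_t x t * coef a t v].

(* The module Δ(l)^* ⊗ Δ(l), free on the (c_s)^* ⊗ c_t, and its pure tensors.  *)
Definition cellTensor (l : weight A) := {ffun (idx l * idx l)%type -> R^o}.

Definition pureTensor (l : weight A) (x y : cellMod l) : cellTensor l :=
  [ffun p => x p.1 * y p.2].

(* [alpha_spec m z] : the bimodule isomorphism α_l from A^{⊵l} / A^{▷l} to     *)
(* Δ(l)^* ⊗ Δ(l), which sends the class of c_st to (c_s)^* ⊗ c_t, maps the     *)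
(* class of m to z.                                                            *)
Definition alpha_spec (l : weight A) (m : A) (z : cellTensor l) : Prop :=
  Age A l m /\ eqmod (Agt A l) m (\sum_p z p *: cbas p.1 p.2).

Definition cell_generator (l : weight A) (x : cellMod l) : Prop :=
  forall y : cellMod l, exists a : A, y = cellAct x a.

End CellModules.

(* An order preserving cell filtration of the restriction along [f : A -> B]   *)
(* of the cell module of B at m. The isomorphism M_{i+1} / M_i -> Δ(l_i) is      *)
(* given by a homomorphism [fquo i] of M_{i+1} onto Δ(l_i) with kernel M_i;     *)
(* its values outside M_{i+1} are irrelevant. The weight of the                 *)
(* subquotient M_{i+1} / M_i has index i, counting from 0.                      *)
Record cellFiltration (R : comNzRingType) (d : Order.disp_t)
    (A B : cellularAlg R d) (f : A -> B) (m : weight B) := CellFiltration {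
  flen : nat;
  fweight : flen.-tuple (weight A);
  fsub : nat -> cellMod m -> Prop;
  fquo : forall i : 'I_flen, cellMod m -> cellMod (tnth fweight i);
  fsub_first : forall x, fsub 0 x <-> x = 0;
  fsub_last : forall x, fsub flen x;
  fsub_incr : forall (i : 'I_flen) x, fsub i x -> fsub i.+1 x;
  fsubD : forall (i : 'I_flen) x y,
    fsub i.+1 x -> fsub i.+1 y -> fsub i.+1 (x + y);
  fsubZ : forall (i : 'I_flen) (c : R) x, fsub i.+1 x -> fsub i.+1 (c *: x);
  fsub_act : forall (i : 'I_flen) (a : A) x,
    fsub i.+1 x -> fsub i.+1 (cellAct x (f a));
  fquoD : forall (i : 'I_flen) x y,
    fsub i.+1 x -> fsub i.+1 y -> fquo i (x + y) = fquo i x + fquo i y;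
  fquoZ : forall (i : 'I_flen) (c : R) x,
    fsub i.+1 x -> fquo i (c *: x) = c *: fquo i x;
  fquo_act : forall (i : 'I_flen) (a : A) x,
    fsub i.+1 x -> fquo i (cellAct x (f a)) = cellAct (fquo i x) a;
  fquo_surj : forall (i : 'I_flen) y, exists2 x, fsub i.+1 x & fquo i x = y;
  fquo_ker : forall (i : 'I_flen) x, fsub i.+1 x -> (fquo i x = 0 <-> fsub i x);
  fweight_decr : forall i j : 'I_flen,
    val j = i.+1 -> (tnth fweight j < tnth fweight i)%O
}.

Arguments fsub {R d A B f m} c _ _ : rename.
Arguments fquo {R d A B f m} c i _ : rename.
Arguments fweight {R d A B f m} c : rename.

Definition split_semisimple (F : fieldType) (B : algType F) : Prop :=
  exists (k : nat) (n : 'I_k -> nat)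
         (psi : forall i : 'I_k, {lrmorphism B -> 'M[F]_((n i).+1)}),
    forall x : (forall i : 'I_k, 'M[F]_((n i).+1)),
      exists! b : B, forall i, psi i b = x i.

(* [phi] exhibits B as A ⊗_R Frac(R), a ⊗ c corresponding to c *: phi a : it is *)
(* a ring homomorphism, semilinear over R -> Frac(R), which carries the         *)
(* cellular R-basis of A to a basis of B over Frac(R).                          *)
Definition is_fraction_extension (R : idomainType) (d : Order.disp_t)
    (A : cellularAlg R d) (B : algType {fraction R})
    (phi : {rmorphism A -> B}) : Prop :=
  (forall (c : R) (a : A), phi (c *: a) = tofrac c *: phi a) /\
  is_basis (fun i => phi (cball (c := A) i)).

(* The inclusions A_s -> A_r, for s <= r, are part of the data. The factors     *)
(* [dfac] and [ufac] only matter on the edges of the branching diagram.         *)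
Record diagramAlgebras (R : idomainType) (d : Order.disp_t) := DiagramAlgebras {
  alg :> nat -> cellularAlg R d;
  incl : forall s r : nat, (s <= r)%N -> {lrmorphism alg s -> alg r};
  incl_inj : forall s r (h : (s <= r)%N), injective (incl h);
  incl_id : forall r (h : (r <= r)%N) (x : alg r), incl h x = x;
  incl_comp : forall s r q (h1 : (s <= r)%N) (h2 : (r <= q)%N) (h : (s <= q)%N)
    (x : alg s), incl h2 (incl h1 x) = incl h x;
  incl_star : forall s r (h : (s <= r)%N) (x : alg s),
    incl h (star x) = star (incl h x);

  delta : forall r (l : weight (alg r)), cellMod l;
  delta_generator : forall r (l : weight (alg r)), cell_generator (delta l);
  mfac : forall r, weight (alg r) -> alg r;
  mfac_alpha : forall r (l : weight (alg r)),
    alpha_spec (mfac l) (pureTensor (delta l) (delta l));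
  mfac_star : forall r (l : weight (alg r)), star (mfac l) = mfac l;

  alg0_scalars : bijective (fun c : R => c%:A : alg 0);
  vac : weight (alg 0);
  weight0 : forall l : weight (alg 0), l = vac;
  idx0 : #|idx vac| = 1%N;
  mfac_vac : mfac vac = 1;

  alg_split : forall r, exists (B : algType {fraction R})
    (phi : {rmorphism alg r -> B}),
    is_fraction_extension phi /\ split_semisimple B;

  filt : forall r (m : weight (alg r.+1)), cellFiltration (incl (leqnSn r)) m;
  edge := fun r (l : weight (alg r)) (m : weight (alg r.+1)) =>
            l \in fweight (filt m);

  dfac : forall r, weight (alg r) -> weight (alg r.+1) -> alg r.+1;
  dfac_spec : forall r (m : weight (alg r.+1)) (i : 'I_(flen (filt m))),
    let l := tnth (fweight (filt m)) i in
    fsub (filt m) i.+1 (cellAct (delta m) (dfac l m)) /\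
    fquo (filt m) i (cellAct (delta m) (dfac l m)) = delta l;

  ufac : forall r, weight (alg r) -> weight (alg r.+1) -> alg r.+1;
  ufac_spec : forall r (m : weight (alg r)) (l : weight (alg r.+1)),
    edge m l -> mfac l * dfac m l = star (ufac m l) * incl (leqnSn r) (mfac m)
}.

Section Paths.

Variables (R : idomainType) (d : Order.disp_t) (A : diagramAlgebras R d).

(* Levels s <= j <= r, and steps from level j to level j.+1 with s <= j < r.   *)
Definition level (s r : nat) := {j : 'I_r.+1 | (s <= j)%N}.
Definition step (s r : nat) := {j : 'I_r | (s <= j)%N}.

Definition mkLevel s r j (hs : (s <= j)%N) (hr : (j <= r)%N) : level s r :=
  exist (fun i : 'I_r.+1 => (s <= i)%N) (Ordinal (hr : (j < r.+1)%N)) hs.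

Definition source s r (e : step s r) : level s r :=
  mkLevel (valP e) (ltnW (ltn_ord (val e))).

Definition target s r (e : step s r) : level s r :=
  mkLevel (leqW (valP e)) (ltn_ord (val e)).

(* A vertex at each level s, ..., r; the edge condition is imposed in [Std].    *)
Definition vpath (s r : nat) :=
  {dffun forall j : level s r, weight (A (val (val j)))}.

Definition at_level s r (t : vpath s r) j (hs : (s <= j)%N) (hr : (j <= r)%N) :
    weight (A j) :=
  t (mkLevel hs hr).

Definition Std s r (h : (s <= r)%N) (l : weight (A s)) (n : weight (A r)) :
    {set vpath s r} :=
  [set t : vpath s r |
    [&& at_level t (leqnn s) h == l, at_level t h (leqnn r) == n &
        [forall e : step s r, edge (t (source e)) (t (target e))]]].

Definition Std0 r (n : weight (A r)) : {set vpath 0 r} :=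
  Std (leq0n r) (vac A) n.

Definition truncate s r p q (hp : (s <= p)%N) (hq : (q <= r)%N) (t : vpath s r) :
    vpath p q :=
  [ffun j : level p q =>
     at_level t (leq_trans hp (valP j))
       (leq_trans (ltn_ord (val j) : (val j <= q)%N) hq)].

(* x ⊵ y is [vpath_le y x], and x ▷ y is [vpath_lt y x]. *)
Definition vpath_le s r (y x : vpath s r) : bool :=
  [forall j : level s r, (y j <= x j)%O].

Definition vpath_lt s r (y x : vpath s r) : bool := vpath_le y x && (x != y).

(* The index type enumerates the steps by increasing level, so that the          *)
(* noncommutative product is taken in the order of the path.                      *)
Definition upath s r (t : vpath s r) : A r :=
  \prod_(e : step s r)
    incl A (ltn_ord (val e)) (ufac (t (source e)) (t (target e))).

Lemma enum_step s r : [seq val (val e) | e <- enum {: step s r}] = iota s (r - s).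
Proof.
have -> : [seq val (val e) | e <- enum {: step s r}] =
          map (val : 'I_r -> nat) (filter (fun j : 'I_r => s <= j)%N (enum 'I_r)).
  rewrite (map_comp (val : 'I_r -> nat) (val : step s r -> 'I_r)); congr map.
  rewrite !enumT [in LHS]unlock /= pmap_filter; last exact: insubK.
  by apply: eq_filter => x; apply: isSome_insub.
rewrite -(filter_map (val : 'I_r -> nat) (fun j => s <= j)%N) val_enum_ord; case: (leqP s r) => [hsr|hrs].
  rewrite -{1}(subnKC hsr) iotaD filter_cat add0n.
  rewrite (eq_in_filter (a2 := pred0)) ?filter_pred0 => [|j].
    apply/all_filterP/allP => j; rewrite mem_iota => /andP[] //.
  by rewrite mem_iota add0n => /andP[_]; rewrite ltnNge => /negbTE.
rewrite (eqnP (ltnW hrs)) (eq_in_filter (a2 := pred0)) ?filter_pred0 // => j.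
rewrite mem_iota add0n => /andP[_ hj].
by apply/negbTE; rewrite -ltnNge (ltn_trans hj).
Qed.

End Paths.

(* Main.v *)
Require Import Defs.
From mathcomp Require Import all_boot all_order all_algebra.

(** Let S denote the star of the product of the u along the part of t above
    level s.  The elements starred along paths of a shape l are right multiples
    of m_l, so w, the difference of the two sides of the hypothesis, has the
    form m_lam b and lies in A_s^{> lam}.  The claim is that the class of
    S w = m_nu q b, where S m_lam = m_nu q, in the cell module of nu is a
    combination of Murphy vectors of paths z with z(s) > lam and z(j) >= t(j)
    for all j > s.

    For each level j <= r let G_j be an up-closed set of weights: everything for
    j < s, the weights > lam for j = s, the weights >= t(j) for j > s.  It spans
    a two-sided ideal A_j^G of A_j.  The relation m d = u^* m moves m_{t(j)}
    across the path, so that S w lies in A_r A_j^G for every j.  Over the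
    fraction field the algebras are split semisimple, so every two-sided ideal
    has a unit; clearing denominators gives e_j in A_j^G and a nonzero scalar
    D_j with x e_j = D_j x for all x in A_j^G ([scaled_unit_exists]).  Hence
    the vector v represented by S w satisfies v e_j = D_j v for all j.

    Conversely, over R itself, every such v in the cell module of l is a
    combination of Murphy vectors of paths that stay in the sets G_j
    ([unit_fixed_murphySpan]).  This goes by induction on the level and along
    the cell filtration: the image of v in a quotient Delta(mu) satisfies the
    same equations, hence is a combination of Murphy vectors of paths to mu; the
    paths prolonged by the edge to l give solutions again, and subtracting
    them moves v one step down the filtration.  At the top level, a nonzero v
    forces l to lie in G, because A^G annihilates the cell modules of all
    weights outside G.  All levels are treated at once, because the conditions
    z(j) in G_j are to hold for one and the same expansion. *)

Set Implicit Arguments.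
Unset Strict Implicit.
Unset Printing Implicit Defensive.

Import Order.TTheory GRing.Theory.

Local Open Scope ring_scope.

(** * Spans *)

Section Span.

Variables (R : comNzRingType) (V : lmodType R) (I : finType).
Implicit Types (P Q : pred I) (b : I -> V).

Lemma span_of0 P b : span_of P b 0.
Proof. by exists (fun=> 0); rewrite big1 // => i _; rewrite scale0r. Qed.

Lemma span_ofD P b x y : span_of P b x -> span_of P b y -> span_of P b (x + y).
Proof.
move=> [f ->] [g ->]; exists (fun i => f i + g i).
by rewrite -big_split; apply: eq_bigr => i _; rewrite scalerDl.
Qed.

Lemma span_ofZ P b (c : R) x : span_of P b x -> span_of P b (c *: x).
Proof.
move=> [f ->]; exists (fun i => c * f i).
by rewrite scaler_sumr; apply: eq_bigr => i _; rewrite scalerA.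
Qed.

Lemma span_ofN P b x : span_of P b x -> span_of P b (- x).
Proof. by rewrite -scaleN1r; apply: span_ofZ. Qed.

Lemma span_ofB P b x y : span_of P b x -> span_of P b y -> span_of P b (x - y).
Proof. by move=> hx hy; apply: span_ofD => //; apply: span_ofN. Qed.

Lemma span_of_gen P b i : P i -> span_of P b (b i).
Proof.
move=> Pi; exists (fun j => (j == i)%:R); rewrite (bigD1 i) //= eqxx scale1r.
by rewrite big1 ?addr0 // => j /andP[_ /negPf ->]; rewrite scale0r.
Qed.

Lemma span_of_sum P b (J : Type) (s : seq J) (Q : pred J) (F : J -> V) :
  (forall j, Q j -> span_of P b (F j)) -> span_of P b (\sum_(j <- s | Q j) F j).
Proof.
by move=> h; apply: big_ind => //; [exact: span_of0 | exact: span_ofD].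
Qed.

(** Coordinates in a basis are unique, which is how membership in a coordinate
    subspace is read off. *)
Lemma basis_span_coord P b (x : I -> R) (i : I) :
  is_basis b -> span_of P b (\sum_i x i *: b i) -> ~~ P i -> x i = 0.
Proof.
move=> hb [y hy] /negPf Pi; case: (hb (\sum_i x i *: b i)) => w [_ uniq_w].
have e1 : w = finfun x by apply: uniq_w; apply: eq_bigr => j _; rewrite ffunE.
have e2 : w = [ffun j => if P j then y j else 0].
  apply: uniq_w; rewrite hy big_mkcond; apply: eq_bigr => j _; rewrite ffunE.
  by case: (P j) => //; rewrite scale0r.
have: w i = 0 by rewrite e2 ffunE Pi.
by rewrite e1 ffunE.
Qed.

End Span.

Lemma span_of_map (R : comNzRingType) (V W : lmodType R) (I J : finType)
    (P : pred I) (Q : pred J) (b : I -> V) (b' : J -> W) (f : {linear V -> W}) x :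
  (forall i, P i -> span_of Q b' (f (b i))) -> span_of P b x ->
  span_of Q b' (f x).
Proof.
move=> h [c ->]; rewrite linear_sum; apply: span_of_sum => i Pi.
by rewrite linearZ; apply: span_ofZ; apply: h.
Qed.

(** * Ideals and cell modules of a cellular algebra *)

Section Cellular.

Variables (R : comNzRingType) (d : Order.disp_t) (A : cellularAlg R d).
Implicit Types (G H : pred (weight A)) (l : weight A) (a b x : A).

Definition upclosed G := forall l m, G l -> (l <= m)%O -> G m.

Definition cellIdeal G : A -> Prop :=
  span_of (fun i => G (tag i)) (cball (c := A)).

Lemma upclosed_gt l : upclosed (fun m => l < m)%O.
Proof. by move=> m n; apply: lt_le_trans. Qed.

Lemma cellIdealS G H x :
  (forall l, G l -> H l) -> cellIdeal G x -> cellIdeal H x.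
Proof.
move=> sGH; apply: (@span_of_map _ _ _ _ _ _ _ _ _ idfun) => i Gi.
exact: (span_of_gen (P := fun i => H (tag i)) _ (sGH _ Gi)).
Qed.

Lemma cellIdeal_cbas G l (s t : idx l) : G l -> cellIdeal G (cbas s t).
Proof.
exact: (span_of_gen (P := fun i => G (tag i)) _
  (i := Tagged (fun l => (idx l * idx l)%type) (s, t))).
Qed.

Lemma cellIdeal_Agt G l x : upclosed G -> G l -> Agt A l x -> cellIdeal G x.
Proof. by move=> upG Gl; apply: cellIdealS => m /ltW; apply: upG. Qed.

Lemma cellIdeal_Age G l x : upclosed G -> G l -> Age A l x -> cellIdeal G x.
Proof. by move=> upG Gl; apply: cellIdealS => m; apply: upG. Qed.

Lemma cellIdealMr G x a : upclosed G -> cellIdeal G x -> cellIdeal G (x * a).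
Proof.
move=> upG; apply: (@span_of_map _ _ _ _ _ _ _ _ _ (a \o* idfun)) => i Gi /=.
case: i Gi => l [s t] /= Gl; rewrite /cball /=.
rewrite -[_ * _](subrK (\sum_v coef a t v *: cbas s v)).
apply: span_ofD; first exact: (cellIdeal_Agt upG Gl (cbas_mulr t a s)).
by apply: span_of_sum => v _; apply: span_ofZ; apply: cellIdeal_cbas.
Qed.

Lemma cellIdeal_star G x : upclosed G -> cellIdeal G x -> cellIdeal G (star x).
Proof.
move=> upG; apply: (span_of_map (f := star)) => -[l [s t]] /= Gl.
rewrite /cball /= -[star _](subrK (cbas t s)); apply: span_ofD.
  exact: (cellIdeal_Agt upG Gl (cbas_star s t)).
exact: cellIdeal_cbas.
Qed.

Lemma cellIdealMl G x a : upclosed G -> cellIdeal G x -> cellIdeal G (a * x).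
Proof.
move=> upG hx; rewrite -[a * x]starK starM.
by apply: cellIdeal_star => //; apply: cellIdealMr => //; apply: cellIdeal_star.
Qed.

Lemma star1 : star (1 : A) = 1.
Proof. by rewrite -[LHS]mulr1 -[X in _ * X]starK -starM mulr1 starK. Qed.

Definition cellSum l (z : cellTensor l) : A := \sum_p z p *: cbas p.1 p.2.

(** The map that [alpha_spec] describes is injective: the c_st of weight l stay
    independent modulo any cell ideal that avoids l. *)
Lemma cellSum_eq0 G l (z : cellTensor l) :
  ~~ G l -> cellIdeal G (cellSum z) -> z = 0.
Proof.
move=> nGl hz; apply/ffunP => p; rewrite ffunE.
pose T q := Tagged (fun l => (idx l * idx l)%type) (q : idx l * idx l).
pose X i := \sum_q (i == T q)%:R * (z q : R).
have Xp q0 : X (T q0) = z q0.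
  rewrite /X (bigD1 q0) //= eqxx mul1r big1 ?addr0 // => q /negPf nq.
  by rewrite eq_Tagged -[tagged _]/q0 eq_sym nq mul0r.
rewrite -Xp; apply: (@basis_span_coord _ _ _ (fun i => G (tag i)) _ X (T p)
  (cbas_basis (c := A)) _ nGl).
suff -> : \sum_i X i *: cball i = cellSum z by [].
rewrite (eq_bigr (fun i => \sum_q ((i == T q)%:R * (z q : R)) *: cball i));
  last first.
  by move=> i _; rewrite scaler_suml.
rewrite exchange_big; apply: eq_bigr => q _ /=.
rewrite (bigD1 (T q)) //= eqxx mul1r big1 ?addr0 // => i /negPf ->.
by rewrite mul0r scale0r.
Qed.

Definition cellRow l (s : idx l) (x : cellMod l) : A := \sum_t x t *: cbas s t.

Lemma cellRowD l (s : idx l) (x y : cellMod l) :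
  cellRow s (x + y) = cellRow s x + cellRow s y.
Proof. by rewrite -big_split; apply: eq_bigr => t _; rewrite ffunE scalerDl. Qed.

Lemma cellRowZ l (s : idx l) c (x : cellMod l) :
  cellRow s (c *: x) = c *: cellRow s x.
Proof. by rewrite scaler_sumr; apply: eq_bigr => t _; rewrite ffunE scalerA. Qed.

Lemma cellRowB l (s : idx l) (x y : cellMod l) :
  cellRow s (x - y) = cellRow s x - cellRow s y.
Proof. by rewrite cellRowD -[- y]scaleN1r cellRowZ scaleN1r. Qed.

Lemma cellSum_pure l (x y : cellMod l) :
  cellSum (pureTensor x y) = \sum_s x s *: cellRow s y.
Proof.
rewrite (eq_bigr (fun s => \sum_t (x s * y t) *: cbas s t)) => [|s _].
  by rewrite pair_big; apply: eq_bigr => p _; rewrite ffunE.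
by rewrite scaler_sumr; apply: eq_bigr => t _; rewrite scalerA.
Qed.

Lemma cellRow_eq0 G l (s : idx l) (x : cellMod l) :
  ~~ G l -> cellIdeal G (cellRow s x) -> x = 0.
Proof.
move=> nGl hx; pose e : cellMod l := [ffun t => (t == s)%:R].
have hz : cellSum (pureTensor e x) = cellRow s x.
  rewrite cellSum_pure (bigD1 s) //= ffunE eqxx scale1r big1 ?addr0 // => t.
  by move=> /negPf nts; rewrite ffunE nts scale0r.
move: hx; rewrite -hz => /(cellSum_eq0 nGl)/ffunP h0.
by apply/ffunP => t; have := h0 (s, t); rewrite !ffunE /= eqxx mul1r.
Qed.

(** A cell module has no algebra structure of its own to compute with; its laws
    are inherited from the algebra by embedding it in each row modulo
    [Agt l]. *)
Lemma cellMod_eq l (x y : cellMod l) :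
  (forall s, eqmod (Agt A l) (cellRow s x) (cellRow s y)) -> x = y.
Proof.
move=> h; apply/eqP; rewrite -subr_eq0; apply/eqP/ffunP => s.
have := h s; rewrite /eqmod -cellRowB.
by move/(cellRow_eq0 (G := fun m => l < m)%O) => ->; rewrite ?ltxx.
Qed.

Lemma AgtMr l x a : Agt A l x -> Agt A l (x * a).
Proof. exact/cellIdealMr/upclosed_gt. Qed.

Lemma eqmod_trans l x y z :
  eqmod (Agt A l) x y -> eqmod (Agt A l) y z -> eqmod (Agt A l) x z.
Proof. by rewrite /eqmod -[x - z](subrKA y) => ? ?; apply: span_ofD. Qed.

Lemma eqmod_sym l x y : eqmod (Agt A l) x y -> eqmod (Agt A l) y x.
Proof. by rewrite /eqmod -[y - x]opprB; apply: span_ofN. Qed.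

Lemma cellRow_act l (s : idx l) (x : cellMod l) a :
  eqmod (Agt A l) (cellRow s x * a) (cellRow s (cellAct x a)).
Proof.
have -> : cellRow s (cellAct x a) = \sum_t x t *: \sum_v coef a t v *: cbas s v.
  under [RHS]eq_bigr do rewrite scaler_sumr.
  rewrite exchange_big; apply: eq_bigr => v _; rewrite ffunE scaler_suml.
  by apply: eq_bigr => t _; rewrite scalerA.
rewrite /eqmod mulr_suml -sumrB; apply: span_of_sum => t _.
by rewrite -scalerAl -scalerBr; apply: span_ofZ; apply: cbas_mulr.
Qed.

Lemma cellActM l (x : cellMod l) a b :
  cellAct x (a * b) = cellAct (cellAct x a) b.
Proof.
apply: cellMod_eq => s; apply: eqmod_trans (cellRow_act _ _ _).
apply: eqmod_trans (eqmod_sym (cellRow_act _ _ _)) _.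
by rewrite /eqmod mulrA -mulrBl; apply: AgtMr; apply: cellRow_act.
Qed.

Lemma cellActDr l (x : cellMod l) a b :
  cellAct x (a + b) = cellAct x a + cellAct x b.
Proof.
apply: cellMod_eq => s; apply: eqmod_trans (eqmod_sym (cellRow_act _ _ _)) _.
by rewrite /eqmod mulrDr cellRowD opprD addrACA; apply: span_ofD; apply: cellRow_act.
Qed.

Lemma cellActZr l (x : cellMod l) c a : cellAct x (c *: a) = c *: cellAct x a.
Proof.
apply: cellMod_eq => s; apply: eqmod_trans (eqmod_sym (cellRow_act _ _ _)) _.
by rewrite /eqmod -scalerAr cellRowZ -scalerBr; apply: span_ofZ; apply: cellRow_act.
Qed.

Lemma cellActBr l (x : cellMod l) a b :
  cellAct x (a - b) = cellAct x a - cellAct x b.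
Proof. by rewrite cellActDr -scaleN1r cellActZr scaleN1r. Qed.

Lemma cellActDl l (x y : cellMod l) a :
  cellAct (x + y) a = cellAct x a + cellAct y a.
Proof.
apply/ffunP => v; rewrite !ffunE -big_split; apply: eq_bigr => t _.
by rewrite ffunE mulrDl.
Qed.

Lemma cellActZl l c (x : cellMod l) a : cellAct (c *: x) a = c *: cellAct x a.
Proof.
apply/ffunP => v; rewrite !ffunE scaler_sumr; apply: eq_bigr => t _.
by rewrite ffunE -scalerAl.
Qed.

Lemma cellAct0l l a : cellAct (0 : cellMod l) a = 0.
Proof. by apply/ffunP => v; rewrite !ffunE big1 // => t _; rewrite ffunE mul0r. Qed.

Lemma cellActBl l (x y : cellMod l) a :
  cellAct (x - y) a = cellAct x a - cellAct y a.
Proof. by rewrite cellActDl -scaleN1r cellActZl scaleN1r. Qed.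

(** For a in the ideal of G, the product of the row of x with a lies in the span
    of the weights that are both above l and in G, all of which differ from
    l. *)
Lemma cellAct_ideal0 G l (x : cellMod l) a :
  upclosed G -> ~~ G l -> cellIdeal G a -> cellAct x a = 0.
Proof.
move=> upG nGl Ga; apply/ffunP => s.
pose H m := (l < m)%O || G m.
suff: cellIdeal H (cellRow s (cellAct x a)).
  by move/(cellRow_eq0 (G := H)) => ->; rewrite // negb_or ltxx.
rewrite -[cellRow _ _](subKr (cellRow s x * a)); apply: span_ofB.
  apply: cellIdealS (cellIdealMl _ upG Ga) => m Gm.
  by rewrite /H Gm orbT.
by apply: cellIdealS (cellRow_act s x a) => m; rewrite /H => ->.
Qed.

Lemma alpha_mulr l m (x y : cellMod l) a :
  alpha_spec m (pureTensor x y) ->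
  eqmod (Agt A l) (m * a) (cellSum (pureTensor x (cellAct y a))).
Proof.
move=> [_ hm]; apply: (eqmod_trans (y := cellSum (pureTensor x y) * a)).
  by rewrite /eqmod -mulrBl; apply: AgtMr.
rewrite !cellSum_pure /eqmod mulr_suml -sumrB; apply: span_of_sum => s _.
by rewrite -scalerAl -scalerBr; apply: span_ofZ; apply: cellRow_act.
Qed.

End Cellular.

Section Annihilator.
Variables (R : idomainType) (d : Order.disp_t) (A : cellularAlg R d).

(** This is the identification of m A modulo A^{> l} with the cell module: it
    rests on m being the square of a generator x, which has a nonzero coordinate
    unless the module is zero, and on R having no zero divisors. *)
Lemma alpha_mulr_Agt (l : weight A) (m : A) (x : cellMod l) a :
  cell_generator x -> alpha_spec m (pureTensor x x) ->
  (Agt A l (m * a) <-> cellAct x a = 0).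
Proof.
move=> gen_x hm; have hma := alpha_mulr a hm; split=> [hma0|xa0].
  have: Agt A l (cellSum (pureTensor x (cellAct x a))).
    by rewrite -[cellSum _](subKr (m * a)); apply: span_ofB.
  move/(cellSum_eq0 (G := fun n => l < n)%O); rewrite ltxx => /(_ isT)/ffunP z0.
  have [x0|nx0] := eqVneq x 0; first by rewrite x0 cellAct0l.
  have [s xs0] : exists s, x s != 0.
    apply/existsP; apply: contraNT nx0; rewrite negb_exists => /forallP x0.
    by apply/eqP/ffunP => s; rewrite ffunE; have /negPn/eqP := x0 s.
  apply/ffunP => v; have /eqP := z0 (s, v).
  by rewrite !ffunE mulf_eq0 (negPf xs0) /= => /eqP.
move: hma; rewrite /eqmod xa0 /cellSum big1 ?subr0 // => p _.
by rewrite !ffunE mulr0 scale0r.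
Qed.

End Annihilator.

(** * Scaled units of the ideals of a cellular algebra *)

Lemma delta_mx_sandwich (F : fieldType) n (u p q : 'I_n) (M : 'M[F]_n) :
  delta_mx u p *m M *m delta_mx q u = M p q *: delta_mx u u.
Proof.
have MuE i j : (delta_mx u p *m M) i j = (i == u)%:R * M p j.
  rewrite mxE (bigD1 p) //= mxE eqxx andbT big1 ?addr0 // => w /negPf nw.
  by rewrite mxE nw andbF mul0r.
apply/matrixP => i j; rewrite mxE (bigD1 q) //= MuE big1 => [|w /negPf nw].
  by rewrite !mxE eqxx addr0 /= mulrAC mulrC -natrM mulnb.
by rewrite [X in _ * X]mxE nw mulr0.
Qed.

(** In a product of matrix algebras a two-sided ideal is the product of the
    factors on which it is nonzero: a nonzero entry in the i-th component yields,
    by multiplication with matrix units on both sides, the identity of the i-th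
    factor.  The sum of these identities is the unit of the ideal. *)
Lemma split_ideal_unit (F : fieldType) (B : algType F) (I : finType)
    (P : pred I) (b : I -> B) :
  split_semisimple B ->
  (forall i a, P i -> span_of P b (a * b i)) ->
  (forall x a, span_of P b x -> span_of P b (x * a)) ->
  exists2 e, span_of P b e & forall x, span_of P b x -> x * e = x.
Proof.
move=> [k [n [psi psi_bij]]] idealMl idealMr.
have surj x : exists y, forall i, psi i y = x i.
  by have [y [hy _]] := psi_bij x; exists y.
have inj x y : (forall i, psi i x = psi i y) -> x = y.
  move=> hxy; have [w [_ uw]] := psi_bij (fun i => psi i y).
  by rewrite -(uw _ hxy) -(uw y).
pose S i := [exists j, P j && (psi i (b j) != 0)].
have blk i : exists p, S i ->
    span_of P b p /\ forall j, psi j p = (j == i)%:R.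
  case: (boolP (S i)) => [/existsP[j /andP[Pj]]|nSi]; last first.
    by exists 0.
  move=> nz; have [p [q xpq]] : exists p q, psi i (b j) p q != 0.
    have: [exists p, [exists q, psi i (b j) p q != 0]].
      apply: contraNT nz; rewrite negb_exists => /forallP h.
      apply/eqP/matrixP => p q; have := h p; rewrite negb_exists.
      by move/forallP => /(_ q); rewrite negbK mxE => /eqP.
    by case/existsP => p /existsP[q]; exists p, q.
  (* Indexing the matrix units by numbers lets one formula serve all sizes. *)
  pose D (u v : nat) : forall i', 'M[F]_((n i').+1) := fun i' =>
    (i' == i)%:R *: \matrix_(u' , v') ((u' == u :> nat) && (v' == v :> nat))%:R.
  have Di (u v : 'I_(n i).+1) : D u v i = delta_mx u v.
    by rewrite /D eqxx scale1r; apply/matrixP => u' v'; rewrite !mxE.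
  have Dj u v i' : i' != i -> D u v i' = 0.
    by move=> /negPf ni; rewrite /D ni scale0r.
  have [l hl] : exists l : 'I_(n i).+1 -> B, forall u i', psi i' (l u) = D u p i'.
    exact: (fin_all_exists (fun u : 'I_(n i).+1 => surj (D u p))).
  have [m hm] : exists m : 'I_(n i).+1 -> B, forall u i', psi i' (m u) = D q u i'.
    exact: (fin_all_exists (fun u : 'I_(n i).+1 => surj (D q u))).
  exists ((psi i (b j) p q)^-1 *: \sum_u l u * b j * m u) => _; split.
    apply: span_ofZ; apply: span_of_sum => u _; apply: idealMr.
    exact: idealMl.
  move=> i'; rewrite linearZ linear_sum /=.
  have [->|ni] := eqVneq i' i; last first.
    by rewrite big1 ?scaler0 // => u _; rewrite !rmorphM /= hl Dj // !mul0r.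
  have -> : \sum_u psi i (l u * b j * m u) =
            \sum_u psi i (b j) p q *: delta_mx u u.
    apply: eq_bigr => u _; rewrite !rmorphM /= hl hm !Di.
    exact: delta_mx_sandwich.
  rewrite -scaler_sumr scalerA mulVf // scale1r.
  apply/matrixP => u v; rewrite summxE (bigD1 u) //= big1 => [|w /negPf nw].
    by rewrite !mxE eqxx addr0 eq_sym.
  by rewrite !mxE eq_sym nw.
have [p hp] := fin_all_exists blk; exists (\sum_(i | S i) p i).
  by apply: span_of_sum => i Si; have [] := hp i Si.
move=> x hx; apply: inj => j; rewrite rmorphM /= linear_sum /=.
case: (boolP (S j)) => Sj.
  rewrite (bigD1 j) //= (hp j Sj).2 eqxx big1 ?addr0 ?mulr1 // => i /andP[Si].
  by rewrite eq_sym (hp i Si).2 => /negPf ->.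
suff -> : psi j x = 0 by rewrite mul0r.
case: hx => c ->; rewrite linear_sum big1 // => i Pi; rewrite linearZ /=.
have -> : psi j (b i) = 0; last by rewrite scaler0.
by apply/eqP; apply: contraNT Sj => nz; apply/existsP; exists i; rewrite Pi.
Qed.

Section Fractions.

Variable R : idomainType.

Import FracField.

Lemma frac_denominator (x : {fraction R}) :
  exists2 d : R, d != 0 & exists n : R, tofrac d * x = tofrac n.
Proof.
elim/quotW: x => x; exists (frac x).2; first exact: denom_ratioP.
exists (frac x).1; unlock tofrac; rewrite -[LHS]pi_mul; apply/eqmodP => /=.
rewrite equivfE /mulf /= !numden_Ratio ?mulf_neq0 ?denom_ratioP ?oner_neq0 //.
by rewrite !mul1r mulr1 mulrC.
Qed.

Lemma common_denominator (I : finType) (x : I -> {fraction R}) :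
  exists2 d : R, d != 0 &
    exists n : I -> R, forall i, tofrac d * x i = tofrac (n i).
Proof.
have /fin_all_exists2[e ne he] i := frac_denominator (x i).
have [m hm] := fin_all_exists he.
exists (\prod_i e i); first by apply/prodf_neq0.
exists (fun i => (\prod_(j | j != i) e j) * m i) => i.
by rewrite (bigD1 i) //= !rmorphM /= -hm mulrCA mulrA.
Qed.

End Fractions.

Section ScaledUnit.

Variables (R : idomainType) (d : Order.disp_t) (A : cellularAlg R d).

(** The scalar D is the price for staying over R: e / D is the unit of the ideal
    over the fraction field. *)
Definition scaled_unit (G : pred (weight A)) (e : A) (D : R) : Prop :=
  [/\ cellIdeal G e, D != 0 & forall x, cellIdeal G x -> x * e = D *: x].

Lemma scaled_unit_exists (G : pred (weight A)) (B : algType {fraction R})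
    (phi : {rmorphism A -> B}) :
  is_fraction_extension phi -> split_semisimple B -> upclosed G ->
  exists e D, scaled_unit G e D.
Proof.
move=> [phiZ phi_basis] splitB upG.
pose P (i : {l : weight A & (idx l * idx l)%type}) := G (tag i).
pose b i := phi (cball (c := A) i).
have phi_inj x y : phi x = phi y -> x = y.
  move=> hxy; apply/eqP; rewrite -subr_eq0; apply/eqP.
  have [c [hc _]] := cbas_basis (c := A) (x - y).
  have: phi (x - y) = 0 by rewrite rmorphB hxy subrr.
  rewrite {1}hc rmorph_sum (eq_bigr (fun i => tofrac (c i) *: b i)) //.
  move=> h; rewrite hc big1 // => i _.
  suff /eqP: tofrac (c i) = 0 by rewrite tofrac_eq0 => /eqP ->; rewrite scale0r.
  apply: (@basis_span_coord _ _ _ pred0 b (fun i => tofrac (c i)) i phi_basis) => //.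
  by rewrite h; apply: span_of0.
have phiI x : cellIdeal G x -> span_of P b (phi x).
  move=> [c ->]; rewrite rmorph_sum; apply: span_of_sum => i Pi.
  by rewrite phiZ; apply: span_ofZ; apply: span_of_gen.
have cI i : P i -> cellIdeal G (cball (c := A) i) by move=> Pi; apply: span_of_gen.
have [||e eI he] := @split_ideal_unit _ B _ P b splitB.
- move=> i a Pi; have [c [-> _]] := phi_basis a; rewrite mulr_suml.
  apply: span_of_sum => j _; rewrite -scalerAl -rmorphM; apply: span_ofZ.
  by apply/phiI/cellIdealMl/cI.
- move=> x a [c ->]; rewrite mulr_suml; apply: span_of_sum => i Pi.
  have [c' [-> _]] := phi_basis a; rewrite mulr_sumr; apply: span_of_sum => j _.
  rewrite -scalerAl -scalerAr -rmorphM; apply: span_ofZ; apply: span_ofZ.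
  by apply/phiI/cellIdealMr/cI.
case: eI => c def_e; have [D nD [m hm]] := common_denominator c.
exists (\sum_(i | P i) m i *: cball i), D.
have phi_e : phi (\sum_(i | P i) m i *: cball i) = tofrac D *: e.
  rewrite rmorph_sum def_e scaler_sumr; apply: eq_bigr => i _.
  by rewrite phiZ scalerA hm.
split=> //; first by exists m.
move=> x /phiI hx; apply: phi_inj.
by rewrite rmorphM /= phi_e phiZ -scalerAr he.
Qed.

Lemma cellAct_scaled_unit0 G e D (l : weight A) (x : cellMod l) :
  upclosed G -> scaled_unit G e D -> cellAct x e = D *: x -> ~~ G l -> x = 0.
Proof.
move=> upG [Ge nD _] xe nGl; move: xe; rewrite (cellAct_ideal0 x upG nGl Ge).
move=> /esym/ffunP h; apply/ffunP => s; have /eqP := h s.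
by rewrite !ffunE mulf_eq0 (negPf nD) => /eqP.
Qed.

End ScaledUnit.

(** * Paths and their products *)

Section PathAlgebra.

Variables (R : idomainType) (d : Order.disp_t) (A : diagramAlgebras R d).

Lemma incl_irr s r (h h' : (s <= r)%N) (x : A s) : incl A h x = incl A h' x.
Proof. by rewrite (bool_irrelevance h h'). Qed.

Lemma at_level_irr s r (t : vpath A s r) j (hs hs' : (s <= j)%N)
    (hr hr' : (j <= r)%N) : at_level t hs hr = at_level t hs' hr'.
Proof. by rewrite (bool_irrelevance hs hs') (bool_irrelevance hr hr'). Qed.

Lemma at_level_truncate s r p q (hp : (s <= p)%N) (hq : (q <= r)%N)
    (t : vpath A s r) j (h1 : (p <= j)%N) (h2 : (j <= q)%N)
    (h3 : (s <= j)%N) (h4 : (j <= r)%N) :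
  at_level (truncate hp hq t) h1 h2 = at_level t h3 h4.
Proof. by rewrite {1}/at_level ffunE; apply: at_level_irr. Qed.

Lemma at_level_level s r (t : vpath A s r) (j : level s r)
    (hs : (s <= val (val j))%N) (hr : (val (val j) <= r)%N) :
  t j = at_level t hs hr.
Proof.
rewrite /at_level; case: j hs hr => [[j jr] sj] hs hr /=.
by rewrite /mkLevel (bool_irrelevance sj hs) (bool_irrelevance jr hr).
Qed.

Lemma StdP s r (h : (s <= r)%N) (l : weight (A s)) (n : weight (A r))
    (t : vpath A s r) :
  t \in Std h l n <->
  [/\ at_level t (leqnn s) h = l, at_level t h (leqnn r) = n &
      forall j (hs : (s <= j)%N) (hr : (j < r)%N),
        edge (at_level t hs (ltnW hr)) (at_level t (leqW hs) hr)].
Proof.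
rewrite inE; split=> [/and3P[/eqP-> /eqP-> /forallP he]|[-> -> he]].
  split=> // j hs hr.
  pose e : step s r := exist (fun i : 'I_r => (s <= i)%N) (Ordinal hr) hs.
  have := he e; rewrite (at_level_level t (j := source e) hs (ltnW hr)).
  by rewrite (at_level_level t (j := target e) (leqW hs) hr).
by rewrite !eqxx; apply/forallP => e; apply: he.
Qed.

Lemma truncate_Std s r p q (h : (s <= r)%N) (hp : (s <= p)%N) (hq : (q <= r)%N)
    (hpq : (p <= q)%N) (l : weight (A s)) (n : weight (A r)) (t : vpath A s r)
    (hp' : (p <= r)%N) (hq' : (s <= q)%N) :
  t \in Std h l n ->
  truncate hp hq t \in Std hpq (at_level t hp hp') (at_level t hq' hq).
Proof.
move=> /StdP[_ _ he]; apply/StdP; split; try exact: at_level_truncate.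
move=> j h1 h2; have h3 := leq_trans hp h1; have h4 := leq_trans h2 hq.
by rewrite (at_level_truncate _ _ _ _ _ h3 (ltnW h4))
           (at_level_truncate _ _ _ _ _ (leqW h3) h4).
Qed.

(** The factor of the path product at level j, as a function of a plain number,
    so that the product is one over an interval and splits at any level. *)
Definition ufactor s r (t : vpath A s r) (j : nat) : A r :=
  match @idP (s <= j)%N, @idP (j < r)%N with
  | ReflectT hs, ReflectT hr =>
    incl A hr (ufac (at_level t hs (ltnW hr)) (at_level t (leqW hs) hr))
  | _, _ => 1
  end.

Lemma ufactorE s r (t : vpath A s r) j (hs : (s <= j)%N) (hr : (j < r)%N) :
  ufactor t j =
  incl A hr (ufac (at_level t hs (ltnW hr)) (at_level t (leqW hs) hr)).
Proof.
rewrite /ufactor; case: {-}_ / idP => // hs'; case: {-}_ / idP => // hr'.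
by rewrite (bool_irrelevance hs' hs) (bool_irrelevance hr' hr).
Qed.

Lemma upath_nat s r (t : vpath A s r) :
  upath t = \prod_(s <= j < r) ufactor t j.
Proof.
rewrite /index_iota -(enum_step s r) big_map enumT.
rewrite /upath [index_enum _]unlock; apply: eq_bigr => e _.
by rewrite (ufactorE t (valP e) (ltn_ord (val e))).
Qed.

Lemma upath_truncate s r p q (hp : (s <= p)%N) (hq : (q <= r)%N)
    (t : vpath A s r) :
  incl A hq (upath (truncate hp hq t)) = \prod_(p <= j < q) ufactor t j.
Proof.
rewrite upath_nat rmorph_prod; apply: eq_big_nat => j /andP[pj jq].
have sj := leq_trans hp pj; have jr := leq_trans jq hq.
rewrite /= (ufactorE _ pj jq) (ufactorE _ sj jr) (incl_comp _ _ jr).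
by rewrite (at_level_truncate _ _ _ _ _ sj (ltnW jr))
           (at_level_truncate _ _ _ _ _ (leqW sj) jr).
Qed.

Lemma upath_split s r j (hs : (s <= j)%N) (hr : (j <= r)%N) (t : vpath A s r) :
  upath t = incl A hr (upath (truncate (leqnn s) hr t)) *
            upath (truncate hs (leqnn r) t).
Proof.
rewrite -[X in _ * X](incl_id (leqnn r)) !upath_truncate upath_nat.
by rewrite (big_cat_nat hs hr).
Qed.

Lemma upath_last s r (hs : (s <= r)%N) (t : vpath A s r.+1) :
  upath t = incl A (leqnSn r) (upath (truncate (leqnn s) (leqnSn r) t)) *
            ufac (at_level t hs (leqnSn r)) (at_level t (leqW hs) (leqnn r.+1)).
Proof.
rewrite upath_truncate upath_nat big_nat_recr //=; congr (_ * _).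
rewrite (ufactorE _ hs (leqnn r.+1)) incl_id.
by congr (ufac _ _); apply: at_level_irr.
Qed.

Lemma upath_id s (t : vpath A s s) : upath t = 1.
Proof. by rewrite upath_nat big_geq. Qed.

(** The intertwining relation m d = u^* m of each edge, composed along a path: it
    carries m from the start of the path to its end.  When the path starts at the
    vacuum, where m is 1, it puts the starred product in m A. *)
Lemma star_upath_mfac s r (h : (s <= r)%N) (l : weight (A s)) (n : weight (A r))
    (t : vpath A s r) :
  t \in Std h l n ->
  exists b : A r, star (upath t) * incl A h (mfac l) = mfac n * b.
Proof.
have base s' (h' : (s' <= s')%N) (l' n' : weight (A s')) t' :
    t' \in Std h' l' n' ->
    exists b, star (upath t') * incl A h' (mfac l') = mfac n' * b.
  move=> /StdP[<- <- _]; exists 1; rewrite upath_id star1 incl_id mul1r mulr1.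
  by congr mfac; apply: at_level_irr.
elim: r h n t => [|r IH] h n t tS.
  by have s0 : s = 0%N; [apply/eqP; rewrite -leqn0|subst s; apply: base tS].
have [hs|rs] := leqP s r; last first.
  have e : s = r.+1 by apply/eqP; rewrite eqn_leq h rs.
  by clear IH rs; subst s; apply: base tS.
have /StdP[e1 e2 /(_ r hs (leqnn _)) he] := tS.
have := truncate_Std (leqnn s) (leqnSn r) hs (leqW hs) hs tS.
rewrite (at_level_irr t _ (leqnn s) _ h) e1 => /IH[b hb].
set mu := at_level t hs (leqnSn r) in hb *.
exists (dfac mu n * incl A (leqnSn r) b).
rewrite (upath_last hs) starM -incl_star -mulrA -(incl_comp hs (leqnSn r)).
rewrite -rmorphM hb rmorphM !mulrA; congr (_ * _).
rewrite (at_level_irr t _ h _ (leqnn r.+1)) e2 ufac_spec //.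
by move: he; rewrite (at_level_irr t _ h _ (leqnn r.+1)) e2
  (at_level_irr t _ hs _ (leqnSn r)).
Qed.

End PathAlgebra.

(** * Prolonging paths *)

Section Extension.

Variables (R : idomainType) (d : Order.disp_t) (A : diagramAlgebras R d).

Lemma ord_top j r : (j < r.+2)%N -> ~ (j <= r)%N -> j = r.+1.
Proof.
by rewrite ltnS leq_eqVlt => /orP[/eqP //|]; rewrite ltnS => h /(_ h).
Qed.

Lemma truncate_Std0 r (l : weight (A r)) (z : vpath A 0 r) j (h : (j <= r)%N) :
  z \in Std0 l ->
  truncate (leqnn 0) h z \in Std0 (at_level z (leq0n j) h).
Proof.
move=> zS; rewrite /Std0 -(weight0 (at_level z (leqnn 0) (leq0n r))).
exact: truncate_Std zS.
Qed.

Definition extend r (z : vpath A 0 r) (n : weight (A r.+1)) : vpath A 0 r.+1 :=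
  [ffun j : level 0 r.+1 =>
     match @idP (val (val j) <= r)%N with
     | ReflectT h => at_level z (leq0n _) h
     | ReflectF nh =>
       eq_rect_r (fun i => weight (A i)) n (ord_top (ltn_ord (val j)) nh)
     end].

Lemma extend_lower r (z : vpath A 0 r) n j (h0 h0' : (0 <= j)%N)
    (h1 : (j <= r.+1)%N) (h : (j <= r)%N) :
  at_level (extend z n) h0 h1 = at_level z h0' h.
Proof.
rewrite {1}/at_level ffunE; case: {-}_ / idP => // h'.
exact: at_level_irr.
Qed.

Lemma extend_top r (z : vpath A 0 r) n (h0 : (0 <= r.+1)%N)
    (h1 : (r.+1 <= r.+1)%N) :
  at_level (extend z n) h0 h1 = n.
Proof.
rewrite /at_level ffunE; case: {-}_ / idP => [h'|nh /=].
  by exfalso; move: h'; rewrite ltnn.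
by rewrite (eq_irrelevance (ord_top _ _) erefl).
Qed.

Lemma truncate_extend r (z : vpath A 0 r) n :
  truncate (leqnn 0) (leqnSn r) (extend z n) = z.
Proof.
apply/ffunP => j; rewrite ffunE.
have hr : (val (val j) <= r)%N by rewrite -ltnS ltn_ord.
by rewrite (extend_lower _ _ _ (leq0n _) _ hr) (at_level_level z (leq0n _) hr).
Qed.

Lemma extend_Std r (z : vpath A 0 r) (l : weight (A r)) (n : weight (A r.+1)) :
  z \in Std0 l -> edge l n -> extend z n \in Std0 n.
Proof.
move=> /StdP[e1 e2 he] ln; apply/StdP; split.
- by rewrite (extend_lower _ _ _ (leqnn 0) _ (leq0n r)).
- exact: extend_top.
move=> j hs hr; have [jr|] := ltnP j r.
  rewrite (extend_lower _ _ _ hs _ (ltnW jr)) (extend_lower _ _ _ (leqW hs) _ jr).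
  exact: he.
move=> rj; have ej : j = r by apply/eqP; rewrite eqn_leq rj -ltnS hr.
clear rj; subst j; rewrite (extend_lower _ _ _ (leq0n r) _ (leqnn r)) extend_top.
by rewrite e2.
Qed.

Lemma upath_extend r (z : vpath A 0 r) (l : weight (A r)) (n : weight (A r.+1)) :
  z \in Std0 l ->
  upath (extend z n) = incl A (leqnSn r) (upath z) * ufac l n.
Proof.
move=> /StdP[_ e2 _]; rewrite (upath_last (leq0n r)) truncate_extend extend_top.
by rewrite (extend_lower _ _ _ (leq0n r) _ (leqnn r)) e2.
Qed.

Definition origin : vpath A 0 0 :=
  [ffun j : level 0 0 =>
     match val (val j) as i return (i <= 0)%N -> weight (A i) with
     | 0 => fun=> vac A
     | i.+1 => fun h => False_rect _ (notF h)
     end (ltn_ord (val j))].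

Lemma origin_Std : origin \in Std0 (vac A).
Proof.
apply/StdP; split; try by rewrite /at_level ffunE.
by move=> j hs hr; exfalso; move: hr.
Qed.

End Extension.

(** * Dominance triangularity *)

Section Triangularity.

Variables (R : idomainType) (d : Order.disp_t) (A : diagramAlgebras R d).
Variable G : forall j, pred (weight (A j)).
Hypothesis upG : forall j, upclosed (G (j := j)).

Definition path_in r (z : vpath A 0 r) : bool := [forall j : level 0 r, G (z j)].

(** Over the fraction field: v lies in v A_j^G for every level j, that is, only
    weights in G_j occur when the module is restricted to A_j. *)
Definition unit_fixed r (l : weight (A r)) (v : cellMod l) : Prop :=
  forall j (h : (j <= r)%N) e D, scaled_unit (G (j := j)) e D ->
  cellAct v (incl A h e) = D *: v.

Definition murphySpan r (l : weight (A r)) : A r -> Prop :=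
  span_of (fun z => (z \in Std0 l) && path_in z) (fun z => star (upath z)).

Lemma exists_scaled_unit j : exists e D, scaled_unit (G (j := j)) e D.
Proof.
have [B [phi [ext_phi splitB]]] := alg_split A j.
exact: scaled_unit_exists ext_phi splitB (@upG j).
Qed.

Lemma path_inP r (z : vpath A 0 r) :
  path_in z <-> forall j (h : (j <= r)%N), G (at_level z (leq0n j) h).
Proof.
split=> [/forallP gz j h|gz]; first exact: (gz (mkLevel (leq0n j) h)).
apply/forallP => j; have hr : (val (val j) <= r)%N by rewrite -ltnS ltn_ord.
by rewrite (at_level_level z (leq0n _) hr).
Qed.

(** This lets identities in the cell module be checked in the algebra. *)
Lemma delta_act_eq r (l : weight (A r)) (x y : A r) :
  Agt (A r) l (mfac l * x - mfac l * y) <->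
  cellAct (delta l) x = cellAct (delta l) y.
Proof.
have [h1 h2] := alpha_mulr_Agt (x - y) (@delta_generator _ _ A r l) (mfac_alpha l).
rewrite -mulrBr; split=> [/h1|exy].
  by rewrite cellActBr => /eqP; rewrite subr_eq0 => /eqP.
by apply: h2; rewrite cellActBr exy subrr.
Qed.

Lemma delta_act_unit r (l : weight (A r)) (y e : A r) (D : R) :
  mfac l * y * e = D *: (mfac l * y) ->
  cellAct (cellAct (delta l) y) e = D *: cellAct (delta l) y.
Proof.
move=> h; rewrite -cellActM -cellActZr; apply/delta_act_eq.
by rewrite mulrA h -scalerAr subrr; apply: span_of0.
Qed.

Lemma cellIdeal_star_upath j (l : weight (A j)) (z : vpath A 0 j) :
  z \in Std0 l -> G l -> cellIdeal (G (j := j)) (star (upath z)).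
Proof.
move=> /star_upath_mfac[b]; rewrite mfac_vac rmorph1 mulr1 => -> Gl.
apply: (cellIdealMr _ (@upG j)); have [hm _] := mfac_alpha l.
exact: (cellIdeal_Age (@upG j) Gl).
Qed.

Lemma scaled_unitMl r j (h : (j <= r)%N) e D (a : A r) (x : A j) :
  scaled_unit (G (j := j)) e D -> cellIdeal (G (j := j)) x ->
  a * incl A h x * incl A h e = D *: (a * incl A h x).
Proof.
by move=> [_ _ he] hx; rewrite -mulrA -rmorphM /= he // linearZ /= scalerAr.
Qed.

(** Cutting the path at level j exhibits its starred product as a left multiple
    of an element of the ideal of G_j. *)
Lemma murphySpan_unit_fixed r (l : weight (A r)) y :
  murphySpan l (mfac l * y) -> unit_fixed (cellAct (delta l) y).
Proof.
move=> [c hc] j h e D he; apply: delta_act_unit; rewrite hc scaler_sumr mulr_suml.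
apply: eq_bigr => z /andP[zS /path_inP/(_ j h) gz].
rewrite (upath_split (leq0n j) h) starM -incl_star -scalerAl scalerA mulrC -scalerA.
congr (_ *: _); apply: scaled_unitMl => //.
exact: (cellIdeal_star_upath (truncate_Std0 h zS)).
Qed.

(** Through the edge relation, the branching factor acts on Murphy vectors by
    prolonging their paths. *)
Lemma murphySpan_edge r (l : weight (A r)) (n : weight (A r.+1)) y :
  edge l n -> G n -> murphySpan l (mfac l * y) ->
  murphySpan n (mfac n * (dfac l n * incl A (leqnSn r) y)).
Proof.
move=> ln Gn [c hc]; rewrite mulrA ufac_spec // -mulrA -rmorphM hc rmorph_sum.
rewrite mulr_sumr; apply: span_of_sum => z /andP[zS gz].
rewrite /= linearZ /= -scalerAr; apply: span_ofZ.
have -> : star (ufac l n) * incl A (leqnSn r) (star (upath z)) =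
          star (upath (extend z n)).
  by rewrite (upath_extend n zS) starM incl_star.
apply: (span_of_gen (P := fun z => (z \in Std0 n) && path_in z)
                    (fun z => star (upath z))).
rewrite (extend_Std zS ln); apply/path_inP => j h.
have [jr|] := leqP j r.
  by rewrite (extend_lower _ _ _ (leq0n j) _ jr); move/path_inP: gz.
move=> rj; have ej : j = r.+1 by apply/eqP; rewrite eqn_leq h rj.
by clear rj; subst j; rewrite extend_top.
Qed.

Lemma unit_fixed_weight r (l : weight (A r)) (v : cellMod l) :
  unit_fixed v -> ~~ G l -> v = 0.
Proof.
move=> fv nGl; have [e [D he]] := exists_scaled_unit r.
apply: (cellAct_scaled_unit0 (@upG r) he _ nGl).
by rewrite -{1}(incl_id (leqnn r) e); apply: fv.
Qed.

Lemma unit_fixedB r (l : weight (A r)) (v w : cellMod l) :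
  unit_fixed v -> unit_fixed w -> unit_fixed (v - w).
Proof.
move=> fv fw j h e D he.
by rewrite cellActBl (fv _ _ _ _ he) (fw _ _ _ _ he) scalerBr.
Qed.

(** The converse of [murphySpan_unit_fixed], and the heart of the proof.  The
    representative y is kept together with v because only the exact equality of
    m y with a combination of starred products, and not its class modulo
    [Agt l], can be transported up an edge. *)
Lemma unit_fixed_murphySpan r (l : weight (A r)) (v : cellMod l) :
  unit_fixed v ->
  exists2 y, cellAct (delta l) y = v & murphySpan l (mfac l * y).
Proof.
have zero r' (l' : weight (A r')) :
    exists2 y, cellAct (delta l') y = 0 & murphySpan l' (mfac l' * y).
  exists 0; last by rewrite mulr0; apply: span_of0.
  by rewrite -(subrr 0) cellActBr subrr.
elim: r l v => [|r IH] l v fv.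
  case: (boolP (G l)) => [Gl|nGl]; last first.
    by rewrite (unit_fixed_weight fv nGl); apply: zero.
  have [y ->] := @delta_generator _ _ A 0 l v; exists y => //.
  have el := weight0 l; subst l; have [g _ hg] := alg0_scalars A.
  rewrite mfac_vac mul1r -(hg y); apply: span_ofZ.
  have -> : (1 : A 0) = star (upath (origin A)) by rewrite upath_id star1.
  apply: (span_of_gen (P := fun z => (z \in Std0 (vac A)) && path_in z)
                      (fun z => star (upath z))).
  rewrite origin_Std; apply/path_inP => j h.
  have ej : j = 0%N by apply/eqP; rewrite -leqn0.
  by subst j; have /StdP[_ e2 _] := origin_Std A;
    rewrite (at_level_irr _ _ (leq0n 0) _ (leqnn 0)) e2.
case: (boolP (G l)) => [Gl|nGl]; last first.
  by rewrite (unit_fixed_weight fv nGl); apply: zero.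
(* Descend the cell filtration, removing the top layer of w at each step. *)
suff filt_ind i : (i <= flen (filt l))%N -> forall w, fsub (filt l) i w ->
    unit_fixed w ->
    exists2 y, cellAct (delta l) y = w & murphySpan l (mfac l * y).
  exact: (filt_ind _ (leqnn _) v (fsub_last (filt l) v) fv).
elim: i => [|i IHi] hi w; first by move=> /fsub_first -> _; apply: zero.
move=> wi fw; pose k := Ordinal hi; set mu := tnth (fweight (filt l)) k.
have ln : edge mu l by apply: mem_tnth.
have fquo_fixed : unit_fixed (fquo (filt l) k w).
  move=> j h e D he; rewrite -(fquo_act (i := k)) // (incl_comp _ _ (leqW h)).
  by rewrite (fw _ _ _ _ he) (fquoZ (i := k)).
(* y1 prolongs by the edge from mu the paths that represent the top layer. *)
have [y0 dy0 my0] := IH _ _ fquo_fixed.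
have [d1 d2] := dfac_spec (m := l) k.
set b := dfac _ l in d1 d2.
pose y1 := b * incl A (leqnSn r) y0.
have my1 : murphySpan l (mfac l * y1) by apply: murphySpan_edge.
have w1i : fsub (filt l) i.+1 (cellAct (delta l) y1).
  by rewrite cellActM; apply: (fsub_act (i := k)).
have w1q : fquo (filt l) k (cellAct (delta l) y1) = fquo (filt l) k w.
  by rewrite cellActM (fquo_act (i := k)) // d2 dy0.
have nw1 : fsub (filt l) i.+1 (- cellAct (delta l) y1).
  by rewrite -scaleN1r; apply: (fsubZ (i := k)).
have [] := IHi (ltnW hi) (w - cellAct (delta l) y1).
- apply/(fquo_ker (i := k)); first exact: (fsubD (i := k)).
  rewrite (fquoD (i := k)) // -scaleN1r (fquoZ (i := k)) // w1q.
  by rewrite scaleN1r subrr.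
- by apply: unit_fixedB => //; apply: murphySpan_unit_fixed.
move=> y2 dy2 my2; exists (y2 + y1); first by rewrite cellActDr dy2 subrK.
by rewrite mulrDr; apply: span_ofD.
Qed.

End Triangularity.

(** * The ideals attached to a path *)

Section PathIdeals.

Variables (R : idomainType) (d : Order.disp_t) (A : diagramAlgebras R d).
Variables (r : nat) (t : vpath A 0 r) (s : nat).

(** The sets G_j for the path t.  The condition at level s is written with [!=]
    rather than as a comparison with a fixed weight of level s, to avoid a
    transport between levels. *)
Definition above j (k : weight (A j)) : bool :=
  match @idP (s <= j)%N, @idP (j <= r)%N with
  | ReflectT _, ReflectT h =>
    (at_level t (leq0n j) h <= k)%O &&
    ((j == s) ==> (k != at_level t (leq0n j) h))
  | _, _ => true
  end.

Lemma aboveE j (h : (j <= r)%N) (k : weight (A j)) : (s <= j)%N ->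
  above k = (at_level t (leq0n j) h <= k)%O &&
            ((j == s) ==> (k != at_level t (leq0n j) h)).
Proof.
move=> hs; rewrite /above; case: {-}_ / idP => // _; case: {-}_ / idP => // h'.
by rewrite (bool_irrelevance h' h).
Qed.

Lemma above_low j (k : weight (A j)) : (j < s)%N -> above k.
Proof.
by move=> js; rewrite /above; case: {-}_ / idP => // sj; rewrite ltnNge sj in js.
Qed.

Lemma above_s (h : (s <= r)%N) (k : weight (A s)) :
  above k = (at_level t (leq0n s) h < k)%O.
Proof. by rewrite (aboveE h) // eqxx /= lt_def andbC. Qed.

Lemma above_gt j (h : (j <= r)%N) (k : weight (A j)) : (s < j)%N ->
  above k = (at_level t (leq0n j) h <= k)%O.
Proof. by move=> sj; rewrite (aboveE h) ?(ltnW sj) // gtn_eqF // andbT. Qed.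

Lemma above_upclosed j : upclosed (@above j).
Proof.
move=> k m; rewrite /above; case: {-}_ / idP => // _; case: {-}_ / idP => // h.
move=> /andP[tk /implyP ntk] km; rewrite (le_trans tk km) /=.
apply/implyP => /ntk nk; rewrite gt_eqF // (lt_le_trans _ km) //.
by rewrite lt_def nk.
Qed.

Lemma path_in_above (hsr : (s < r)%N) (z : vpath A 0 r) :
  path_in above z ->
  vpath_lt (truncate (leq0n s) (leqnn r) t) (truncate (leq0n s) (leqnn r) z) &&
  (at_level t (leq0n s) (ltnW hsr) < at_level z (leq0n s) (ltnW hsr))%O.
Proof.
move=> /path_inP gz; have := gz s (ltnW hsr); rewrite (above_s (ltnW hsr)) => lt_s.
rewrite lt_s andbT; apply/andP; split.
  apply/forallP => j; have sj := valP j.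
  have jr : (val (val j) <= r)%N by rewrite -ltnS ltn_ord.
  rewrite (at_level_level _ sj jr) (at_level_level (truncate _ _ z) sj jr).
  rewrite !(at_level_truncate _ _ _ _ _ (leq0n _) jr).
  by have := gz _ jr; rewrite (aboveE jr) // => /andP[].
apply: contraTneq lt_s => /(congr1 (fun p => at_level p (leqnn s) (ltnW hsr))).
rewrite !(at_level_truncate _ _ _ _ _ (leq0n s) (ltnW hsr)) => ->.
by rewrite ltxx.
Qed.

End PathIdeals.

Theorem corollary3p12 (R : idomainType) (d : Order.disp_t)
    (A : diagramAlgebras R d) (r : nat) (hr : (1 < r)%N)
    (nu : weight (A r)) (t : vpath A 0 r) (ht : t \in Std0 nu)
    (s : nat) (hs : (1 <= s)%N) (hsr : (s < r)%N)
    (lam : weight (A s)) (hlam : lam = at_level t (leq0n s) (ltnW hsr))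
    (a : A s) (c : vpath A 0 s -> R) :
  eqmod (Agt (A s) lam)
    (star (upath (truncate (leqnn 0) (ltnW hsr) t)) * a)
    (\sum_(x in Std0 lam) c x *: star (upath x)) ->
  exists c' : vpath A 0 r -> R,
    eqmod (Agt (A r) nu)
      (star (upath t) * incl A (ltnW hsr) a)
      (\sum_(x in Std0 lam)
          c x *: (star (upath (truncate (leq0n s) (leqnn r) t)) *
                  incl A (ltnW hsr) (star (upath x))) +
       \sum_(z in Std0 nu |
               vpath_lt (truncate (leq0n s) (leqnn r) t)
                        (truncate (leq0n s) (leqnn r) z) &&
               (lam < at_level z (leq0n s) (ltnW hsr))%O)
          c' z *: star (upath z)).
Proof.
set T := star (upath (truncate (leq0n s) (leqnn r) t)).
set X := \sum_(x in Std0 lam) c x *: star (upath x) => hX.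
pose w := star (upath (truncate (leqnn 0) (ltnW hsr) t)) * a - X.
have upath_mfac x : x \in Std0 lam -> exists b, star (upath x) = mfac lam * b.
  by move=> /star_upath_mfac[b]; rewrite mfac_vac rmorph1 mulr1 => ->; exists b.
have [b wb] : exists b, w = mfac lam * b.
  have [b0 Xb] : exists b, X = mfac lam * b.
    rewrite /X; apply: (big_ind (fun y => exists b, y = mfac lam * b)).
    - by exists 0; rewrite mulr0.
    - by move=> _ _ [b1 ->] [b2 ->]; exists (b1 + b2); rewrite mulrDr.
    by move=> x /upath_mfac[b ->]; exists (c x *: b); rewrite scalerAr.
  have := truncate_Std0 (ltnW hsr) ht; rewrite -hlam => /upath_mfac[b tb].
  rewrite /w tb.
  by exists (b * a - b0); rewrite Xb mulrBr mulrA.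
have [_ et_r _] := (StdP _ _ _ _).1 ht.
have tS := truncate_Std (leq0n s) (leqnn r) (ltnW hsr) (ltnW hsr) (leq0n r) ht.
rewrite -hlam et_r in tS; have [q Tq] := star_upath_mfac tS; rewrite -/T in Tq.
pose y := q * incl A (ltnW hsr) b.
have my : mfac nu * y = T * incl A (ltnW hsr) w.
  by rewrite wb rmorphM /= !mulrA Tq.
(* The element m_nu y lies in A_r A_j^G at every level from s on. *)
have w_above j (hsj : (s <= j)%N) (hjr : (j <= r)%N) :
    exists u, exists2 x, cellIdeal (above t s (j := j)) x &
      mfac nu * y = u * incl A hjr x.
  have [/[dup] hsj' js|sj] := leqP j s.
    have ej : j = s by apply/eqP; rewrite eqn_leq js hsj.
    subst j; exists T, w; last by rewrite my; congr (_ * _); apply: incl_irr.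
    by apply: cellIdealS hX => k; rewrite (above_s _ (ltnW hsr)) -hlam.
  have [eT _ _] := (StdP _ _ _ _).1 tS.
  have := truncate_Std (leqnn s) hjr hsj (ltnW hsr) hsj tS.
  rewrite eT (at_level_truncate _ _ _ _ _ (leq0n j) hjr) => /star_upath_mfac[q' Tq'].
  set mu := at_level t (leq0n j) hjr in Tq'.
  exists (star (upath (truncate hsj (leqnn r) (truncate (leq0n s) (leqnn r) t)))).
  exists (mfac mu * (q' * incl A hsj b)).
    apply: (cellIdealMr _ (above_upclosed (j := j))).
    apply: (cellIdeal_Age (l := mu)); first exact: above_upclosed.
      by rewrite (above_gt t hjr).
    by have [] := mfac_alpha mu.
  rewrite my /T (upath_split hsj hjr) starM -incl_star -mulrA; congr (_ * _).
  by rewrite -(incl_comp hsj hjr) -rmorphM wb (rmorphM (incl A hsj)) !mulrA Tq'.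
have y_fixed : unit_fixed (@above _ _ A r t s) (cellAct (delta nu) y).
  move=> j h e D he; apply: delta_act_unit.
  have [sj|js] := leqP s j.
    have [u [x hx ->]] := w_above j sj h; exact: scaled_unitMl he hx.
  (* Below level s the ideal is all of A_j, so the scaled unit is D itself. *)
  have [_ _ /(_ 1)] := he; rewrite mul1r => ->.
    by rewrite linearZ /= rmorph1 -scalerAr mulr1.
  have [f [-> _]] := cbas_basis (c := A j) 1.
  by exists f; apply: eq_bigl => i; rewrite above_low.
have [y' dy' [c' hc']] :=
  unit_fixed_murphySpan (above_upclosed (t := t) (s := s)) y_fixed.
exists (fun z => if path_in (above t s) z then c' z else 0).
have lhs : star (upath t) * incl A (ltnW hsr) a -
    \sum_(x in Std0 lam) c x *: (T * incl A (ltnW hsr) (star (upath x))) =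
    mfac nu * y.
  rewrite my /w rmorphB rmorphM /= mulrBr; congr (_ - _).
    by rewrite mulrA incl_star -starM -upath_split.
  rewrite rmorph_sum mulr_sumr; apply: eq_bigr => x _.
  by rewrite /= linearZ /= scalerAr.
have rhs : \sum_(z in Std0 nu | vpath_lt (truncate (leq0n s) (leqnn r) t)
                        (truncate (leq0n s) (leqnn r) z) &&
               (lam < at_level z (leq0n s) (ltnW hsr))%O)
    (if path_in (above t s) z then c' z else 0) *: star (upath z) = mfac nu * y'.
  rewrite hc' big_mkcond [RHS]big_mkcond; apply: eq_bigr => z _.
  case: (boolP (path_in _ z)) => gz; last by rewrite scale0r andbF if_same.
  by have := path_in_above hsr gz; rewrite -hlam => ->.
by rewrite /eqmod opprD addrA lhs rhs; apply/delta_act_eq.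
Qed.
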